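(* Let $\preceq$ be a reflexive binary relation on a subset of the probability measures on Cantor space $2^{\mathbb{N}}$ with full support. Let $\nu$ and $\mu$ be computable probability measures on $2^{\mathbb{N}}$ with full support. If $\mathsf{MR}_2^{\nu}(\preceq, \mathscr{F}_{n+1}, H)$ has $\nu$-measure one and $\nu\preceq \mu$, then $\nu$ is absolutely continuous with respect to $\mu$, i.e. $\nu\ll \mu$.
   Context: A probability measure $\nu$ on Cantor space is identified with the function $\sigma\mapsto\nu(\sigma):=\nu([\sigma])$ on $2^{<\mathbb{N}}$, where $[\sigma]$ is the set of $\omega\in 2^{\mathbb{N}}$ extending $\sigma$. It is computable if the reals $\nu(\sigma)$ are computable uniformly in $\sigma$; it has full support if $\nu(\sigma)>0$ for all $\sigma$. $\omega\upharpoonright n$ is the length-$n$ initial segment of $\omega$. $\mathscr{F}_n$ is the $\sigma$-algebra generated by the sets $[\sigma]$ with $|\sigma|=n$. Hellinger distance: for probability measures $P\ll Q$ on a $\sigma$-algebra, $H(P,Q)=\big(2(1-\mathbb{E}_Q[(\frac{dP}{dQ})^{1/2}])\big)^{1/2}$. For $\nu,\mu$ with full support, $H_{\mathscr{F}_{n+1}}(\nu,\mu)(\omega)$ denotes $H(P,Q)$ where $P,Q$ are the restrictions to $\mathscr{F}_{n+1}$ of the conditional measures $\nu(\cdot\mid[\omega\upharpoonright n])$ and $\mu(\cdot\mid[\omega\upharpoonright n])$, respectively. $\mathsf{MR}^{\nu}_2(\preceq,\mathscr{F}_{n+1},H)$ is the set of $\omega\in2^{\mathbb{N}}$ such that for all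 computable probability measures $\mu'$ with full support and $\nu\preceq\mu'$, one has $\sum_n \big(H_{\mathscr{F}_{n+1}}(\nu,\mu')(\omega)\big)^2<\infty$. *)

(* Defs.v *)
From HB Require Import structures.
From mathcomp Require Import all_boot all_order all_algebra.
From mathcomp Require Import all_classical all_reals all_analysis.

Set Implicit Arguments.
Unset Strict Implicit.
Unset Printing Implicit Defensive.

Import Order.TTheory GRing.Theory Num.Theory.

Local Open Scope classical_set_scope.
Local Open Scope ring_scope.

(* The total recursive functions of several natural variables: the least class
   containing the basic functions and closed under composition, primitive
   recursion and minimisation of regular functions (in [rec_min], the existence
   of the total function [h] forces [f] to be regular). *)
Inductive recursive : forall k : nat, (k.-tuple nat -> nat) -> Prop :=
| rec_zero k : recursive (fun _ : k.-tuple nat => 0%N)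
| rec_succ : recursive (fun v : 1.-tuple nat => (thead v).+1)
| rec_proj k (i : 'I_k) : recursive (fun v : k.-tuple nat => tnth v i)
| rec_comp k m (f : m.-tuple nat -> nat) (g : 'I_m -> k.-tuple nat -> nat) :
    recursive f -> (forall i, recursive (g i)) ->
    recursive (fun v : k.-tuple nat => f [tuple g i v | i < m])
| rec_prim k (f : k.-tuple nat -> nat) (g : k.+2.-tuple nat -> nat)
    (h : k.+1.-tuple nat -> nat) :
    recursive f -> recursive g ->
    (forall v : k.-tuple nat, h [tuple of 0%N :: v] = f v) ->
    (forall n (v : k.-tuple nat), h [tuple of n.+1 :: v] =
       g [tuple of n :: h [tuple of n :: v] :: v]) ->
    recursive h
| rec_min k (f : k.+1.-tuple nat -> nat) (h : k.-tuple nat -> nat) :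
    recursive f ->
    (forall v : k.-tuple nat, f [tuple of h v :: v] = 0%N) ->
    (forall (v : k.-tuple nat) m, (m < h v)%N -> f [tuple of m :: v] <> 0%N) ->
    recursive h.

(* Bijective base-2 numeration: a bijection from finite binary strings to nat. *)
Definition string_code (s : seq bool) : nat :=
  foldr (fun (b : bool) c => (c.*2 + b.+1)%N) 0%N s.

Definition computable_rat_family (q : seq bool -> nat -> rat) : Prop :=
  exists a b c : 2.-tuple nat -> nat,
    [/\ recursive a, recursive b, recursive c &
        forall s n, let v := [tuple string_code s; n] in
          q s n = ((a v)%:R - (b v)%:R) / (c v).+1%:R].

Definition uniformly_computable (R : realType) (x : seq bool -> R) : Prop :=
  exists2 q, computable_rat_family q &
    forall s n, `|x s - ratr (q s n)| <= 2 ^- n.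

Definition restrict (w : cantor_space) (n : nat) : seq bool := mkseq w n.

Definition cylinder (s : seq bool) : set cantor_space :=
  [set w | restrict w (size s) = s].

Definition cylinders : set (set cantor_space) := range cylinder.

Definition cylinders_of_length (n : nat) : set (set cantor_space) :=
  [set cylinder s | s in [set s | size s = n]].

(* Cantor space with its Borel sigma-algebra; see [borel_cantorE]. *)
Definition cantor : Type := g_sigma_algebraType cylinders.
HB.instance Definition _ := Measurable.on cantor.

(* Cantor space with the sigma-algebra F_n. *)
Definition cantorF (n : nat) : Type :=
  g_sigma_algebraType (cylinders_of_length n).
HB.instance Definition _ n := Measurable.on (cantorF n).

Lemma measurable_cylinder (s : seq bool) :
  measurable (cylinder s : set cantor).
Proof. by apply: sub_sigma_algebra; exists s. Qed.

Lemma in_cylinder (v w : cantor_space) n :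
  cylinder (restrict w n) v <-> forall i, (i < n)%N -> v i = w i.
Proof.
rewrite /cylinder /restrict /= size_mkseq; split=> [vw i lti|vw].
  by have := congr1 (nth false ^~ i) vw; rewrite !nth_mkseq.
apply: (@eq_from_nth _ false); rewrite !size_mkseq// => i lti.
by rewrite !nth_mkseq// vw.
Qed.

Lemma open_cylinder (s : seq bool) : open (cylinder s).
Proof.
have -> : cylinder s = \bigcap_(i < size s)
    ((fun w : cantor_space => w i) @^-1` [set nth false s i]).
  apply/seteqP; split=> w.
    by move=> ws i /= lt_is; rewrite -ws nth_mkseq.
  move=> ws; rewrite /cylinder /restrict /=.
  apply: (@eq_from_nth _ false); rewrite size_mkseq// => i lt_is.
  by rewrite nth_mkseq// (ws i lt_is).
rewrite bigcap_mkord.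
elim/big_ind : _ => [|A B oA oB|i _]; [exact: openT|exact: openI|].
apply: open_comp; last exact: discrete_open.
by move=> w _; exact: (@proj_continuous nat (fun=> bool) i w).
Qed.

Lemma nbhs_cylinder (w : cantor_space) (U : set cantor_space) :
  nbhs w U -> exists n, cylinder (restrict w n) `<=` U.
Proof.
pose F := filter_from [set: nat] (fun n => cylinder (restrict w n)).
have FF : Filter F.
  apply: filter_from_filter; first by exists 0%N.
  move=> m n _ _; exists (maxn m n) => // v /in_cylinder vw.
  by split; apply/in_cylinder => i lti; apply: vw; rewrite leq_max lti ?orbT.
suff Fw : F --> w by move=> /Fw[n _ nU]; exists n.
have fsurj i : (fun v : cantor_space => v i) @` [set: cantor_space] = [set: bool].
  by apply/seteqP; split=> // b _; exists (fun=> b).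
apply/cvg_sup => i; apply/cvg_image => //.
move=> V /nbhs_singleton Vwi /=; exists ((fun v : cantor_space => v i) @^-1` V).
  by exists i.+1 => // v /in_cylinder/(_ i (leqnn _)) /= ->.
exact: image_preimage.
Qed.

Lemma borel_cantorE : @measurable _ cantor = <<s @open cantor_space >>.
Proof.
rewrite [LHS](_ : _ = <<s cylinders >>)//; apply/seteqP.
split; apply: smallest_sub; try exact: smallest_sigma_algebra.
  by move=> _ [s _ <-]; apply: sub_sigma_algebra; exact: open_cylinder.
move=> U oU.
have -> : U = \bigcup_(s in [set s | cylinder s `<=` U]) cylinder s.
  apply/seteqP; split=> [w Uw|w [s sU]]; last exact: sU.
  have [n nU] := nbhs_cylinder (open_nbhs_nbhs (conj oU Uw)).
  by exists (restrict w n) => //; apply/in_cylinder.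
rewrite bigcup_mkcond.
apply: (@countable_bigcupT_measurable _ cantor) => // s.
by case: ifP => // _; exact: measurable_cylinder.
Qed.

Definition toF (n : nat) (w : cantor) : cantorF n := w.

Lemma measurable_toF n : measurable_fun [set: cantor] (toF n).
Proof.
move=> _ A; rewrite setTI; apply: smallest_sub => //.
  exact: (@sigma_algebra_measurable _ cantor).
by move=> _ [s _ <-]; exact: measurable_cylinder.
Qed.

HB.instance Definition _ n :=
  isMeasurableFun.Build _ _ cantor (cantorF n) (toF n) (@measurable_toF n).

Section measures_on_cantor.
Context {R : realType}.
Implicit Types nu mu : probability cantor R.

Definition computable_measure nu : Prop :=
  uniformly_computable (fun s => fine (nu (cylinder s))).

Definition full_support nu : Prop := forall s, (0 < nu (cylinder s))%E.

(* nu(. | [s]); the last argument of [mnormalize] is only used when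
   nu [s] = 0. *)
Definition conditional nu (s : seq bool) : probability cantor R :=
  mnormalize (mrestr nu (measurable_cylinder s)) nu.

Definition restrictF (n : nat) nu : probability (cantorF n) R :=
  distribution nu (toF n).

End measures_on_cantor.

(* [Radon_Nikodym] is a genuine derivative when P is absolutely continuous with respect to Q. *)
Definition hellinger d (T : measurableType d) (R : realType)
    (P Q : probability T R) : R :=
  Num.sqrt (2 * (1 - fine 'E_Q[fun x =>
    Num.sqrt (fine (Radon_Nikodym (charge_of_finite_measure P) Q x))])).

Section merging.
Context {R : realType}.
Implicit Types nu mu : probability cantor R.

(* H_{F_(n+1)}(nu, mu)(w): the index n is that of the conditioning prefix. *)
Definition hellingerF (n : nat) nu mu (w : cantor) : R :=
  hellinger (restrictF n.+1 (conditional nu (restrict w n)))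
            (restrictF n.+1 (conditional mu (restrict w n))).

Definition MR2_hellinger nu
    (prec : probability cantor R -> probability cantor R -> Prop) : set cantor :=
  [set w | forall mu', computable_measure mu' -> full_support mu' ->
     prec nu mu' ->
     (\sum_(n <oo) (hellingerF n nu mu' w ^+ 2)%:E < +oo)%E].

Definition reflexive_relation_on (S : set (probability cantor R))
    (prec : probability cantor R -> probability cantor R -> Prop) : Prop :=
  (forall nu mu, prec nu mu -> S nu /\ S mu) /\ (forall nu, S nu -> prec nu nu).

End merging.

(* Main.v *)
(* For a string s let u(s) be half the squared Hellinger distance between the
   conditional laws of the next bit under nu and mu. By hypothesis, for nu-almost
   every w the tail sums of u(w|k) become smaller than any r > 0, so it suffices
   to bound nu(A /\ E) by 4 r when mu(A) = 0 and E is the event that the sums of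
   u(w|k) from k = m on stay at most r. Stopping the tree below a string s of
   length m as soon as the budget r is exhausted, the Hellinger affinity between
   nu and mu restricted to the cylinder of s is at least 1 - r at every finite
   level (a factor 1 - u costs at most u), and p <= 2 q + 2 (sqrt p - sqrt q)^2
   turns this into nu(C /\ E) <= 2 K mu(C) + 4 r nu(s) for clopen C inside the
   cylinder, with K = nu(s) / mu(s). Approximating A by clopen sets in both
   measures then gives the bound. *)
Require Import Defs.
From mathcomp Require Import all_boot all_order all_algebra.
From mathcomp Require Import all_classical all_reals all_analysis.
From mathcomp Require Import measurable_realfun ring lra.

Set Implicit Arguments.
Unset Strict Implicit.
Unset Printing Implicit Defensive.

Import Order.TTheory GRing.Theory Num.Theory.

Local Open Scope classical_set_scope.
Local Open Scope ring_scope.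

(* [mathcomp.classical.functions] also exports a [restrict]. *)
Local Notation restrict := Defs.restrict.

(** * Real-valued arithmetic of probabilities *)

Section finite_measure_fine.
Context d (T : measurableType d) (R : realType) (P : probability T R).

Lemma fine_measure_setDI (A B : set T) : measurable A -> measurable B ->
  fine (P A) = fine (P (A `\` B)) + fine (P (A `&` B)).
Proof.
move=> mA mB; rewrite (measureDI P mA mB) fineD//; apply: fin_num_measure.
  exact: measurableD.
exact: measurableI.
Qed.

Lemma fine_measure_le (A B : set T) : measurable A -> measurable B ->
  A `<=` B -> fine (P A) <= fine (P B).
Proof.
move=> mA mB AB.
by rewrite fine_le ?fin_num_measure// le_measure ?inE.
Qed.

Lemma fine_measure_ge0 (A : set T) : 0 <= fine (P A).
Proof. exact: fine_ge0. Qed.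

Lemma null_fine_measure (A : set T) : measurable A ->
  fine (P A) = 0 -> P A = 0%E.
Proof. by move=> mA PA0; rewrite -[LHS]fineK ?PA0// fin_num_measure. Qed.

Lemma fine_measure_leU (A B C : set T) :
  measurable A -> measurable B -> measurable C ->
  A `<=` B `|` C -> fine (P A) <= fine (P B) + fine (P C).
Proof.
move=> mA mB mC ABC.
rewrite -fineD ?fin_num_measure// fine_le ?fin_numD ?fin_num_measure//.
by apply: le_trans (measureU2 P mB mC); rewrite le_measure ?inE//; exact: measurableU.
Qed.

(** The differences decrease to the empty set, so continuity from above applies. *)
Lemma near_fine_measure_setD (F : (set T)^nat) (e : R) : 0 < e ->
  (forall n, measurable (F n)) -> nondecreasing_seq F ->
  \forall n \near \oo, fine (P ((\bigcup_k F k) `\` F n)) < e.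
Proof.
move=> e0 mF ndF; set A := \bigcup_k F k.
have mA : measurable A by exact: bigcup_measurable.
have mAF n : measurable (A `\` F n) by exact: measurableD.
have cap0 : \bigcap_n (A `\` F n) = set0.
  by apply/seteqP; split=> // w h; have [[n _ Fnw] _] := h 0%N I; have [] := h n I.
have cvg0 : (P \o (fun n => A `\` F n)) n @[n --> \oo] --> 0%:E.
  rewrite (_ : 0%:E = P (\bigcap_n (A `\` F n))); last by rewrite cap0 measure0.
  apply: nonincreasing_cvg_mu => //.
  - by rewrite ltey_eq fin_num_measure.
  - by apply: bigcap_measurable.
  - move=> m n mn; apply/subsetPset => w [Aw nFw]; split=> // Fw.
    by apply: nFw; have /subsetPset := ndF _ _ mn; exact.
exact: (cvgr_lt _ (fine_cvg cvg0)).
Qed.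

End finite_measure_fine.

(** * The binary tree of cylinders and its clopen sets *)

Section cylinder_tree.

Lemma restrictS (w : cantor) n : restrict w n.+1 = rcons (restrict w n) (w n).
Proof. exact: mkseqS. Qed.

Lemma take_restrict (w : cantor) k n : (k <= n)%N ->
  take k (restrict w n) = restrict w k.
Proof. by move=> kn; rewrite /Defs.restrict -map_take take_iota (minn_idPl kn). Qed.

Lemma restrict_cylinder (s : seq bool) (w : cantor) :
  cylinder s w -> restrict w (size s) = s.
Proof. by []. Qed.

Lemma cylinder_rcons (s : seq bool) (b : bool) (w : cantor) :
  cylinder (rcons s b) w <-> cylinder s w /\ w (size s) = b.
Proof.
rewrite /cylinder /= size_rcons restrictS; split=> [/rcons_inj[]//|].
by move=> [-> ->].
Qed.

(** The clopen sets, coded by a boolean test so that a single string of length [n] settles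
    membership. *)
Definition prefix_set n (p : pred (seq bool)) : set cantor :=
  [set w : cantor | p (restrict w n)].

Lemma measurable_prefix_set n (p : pred (seq bool)) :
  measurable (prefix_set n p).
Proof.
have -> : prefix_set n p =
    \bigcup_(s in [set s | p s && (size s == n)]) cylinder s.
  apply/seteqP; split=> [w /= pw|w [s /= /andP[ps /eqP <-]]]; last first.
    by move=> sw; rewrite /prefix_set/= (restrict_cylinder sw).
  exists (restrict w n) => /=; first by rewrite pw size_mkseq eqxx.
  exact/in_cylinder.
rewrite bigcup_mkcond; apply: (@countable_bigcupT_measurable _ cantor) => // s.
by case: ifP => // _; exact: measurable_cylinder.
Qed.

Lemma fine_measure_cylinderI (R : realType) (P : probability cantor R)
    (s : seq bool) (A : set cantor) : measurable A ->
  fine (P (cylinder s `&` A)) = fine (P (cylinder (rcons s true) `&` A)) +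
                                fine (P (cylinder (rcons s false) `&` A)).
Proof.
move=> mA.
have mC u : measurable (cylinder u `&` A : set cantor).
  by apply: measurableI => //; exact: measurable_cylinder.
rewrite (fine_measure_setDI _ (mC s) (measurable_cylinder (rcons s false))).
congr (fine (P _) + fine (P _)); apply/seteqP; split=> w /=.
- move=> [[sw Aw] nsw]; split=> //; apply/cylinder_rcons; split=> //.
  by apply/negPn/negP => /negPf h; apply: nsw; apply/cylinder_rcons.
- move=> [/cylinder_rcons[sw ws] Aw]; split=> // /cylinder_rcons[_].
  by rewrite ws.
- by move=> [[_ Aw] sw].
- by move=> [/[dup] /cylinder_rcons[sw _] rw Aw].
Qed.

Lemma fine_measure_cylinder (R : realType) (P : probability cantor R)
    (s : seq bool) :
  fine (P (cylinder s)) = fine (P (cylinder (rcons s true))) +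
                          fine (P (cylinder (rcons s false))).
Proof.
by have := fine_measure_cylinderI P s measurableT; rewrite !setIT.
Qed.

End cylinder_tree.

(** * Hellinger affinity along the tree and the stopped-tree estimate *)

Section hellinger_defect.
Context (R : realType) (nu mu : probability cantor R).
Hypotheses (nu_full : full_support nu) (mu_full : full_support mu).

Let x s : R := fine (nu (cylinder s)).
Let y s : R := fine (mu (cylinder s)).

(* The Hellinger affinity of the conditional laws of the bit following [s]. *)
Definition affinity (s : seq bool) : R :=
  (Num.sqrt (x (rcons s true) * y (rcons s true)) +
   Num.sqrt (x (rcons s false) * y (rcons s false))) / Num.sqrt (x s * y s).

Lemma mass_gt0 (P : probability cantor R) s : full_support P ->
  0 < fine (P (cylinder s)).
Proof.
move=> fP; rewrite fine_gt0// fP/=.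
rewrite ltey_eq fin_num_measure//; exact: measurable_cylinder.
Qed.

Let x_gt0 s : 0 < x s. Proof. exact: mass_gt0. Qed.
Let y_gt0 s : 0 < y s. Proof. exact: mass_gt0. Qed.

(** Cauchy-Schwarz for the square roots of the children's masses. By Lagrange's identity the deficit
    is the square $(a' e' - b' c')^2$. *)
Lemma affinity_le1 s : affinity s <= 1.
Proof.
rewrite ler_pdivrMr ?sqrtr_gt0 ?mulr_gt0// mul1r.
have xs : x s = x (rcons s true) + x (rcons s false) by exact: fine_measure_cylinder.
have ys : y s = y (rcons s true) + y (rcons s false) by exact: fine_measure_cylinder.
rewrite xs ys.
have := x_gt0 (rcons s true); have := x_gt0 (rcons s false).
have := y_gt0 (rcons s true); have := y_gt0 (rcons s false).
move: (x _) (x _) (y _) (y _) => a b c e e0 c0 b0 a0.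
rewrite -[leLHS]ger0_norm ?addr_ge0 ?sqrtr_ge0// -sqrtr_sqr.
rewrite ler_sqrt; last by rewrite mulr_ge0 ?addr_ge0// ltW.
rewrite (sqrtrM _ (ltW a0)) (sqrtrM _ (ltW b0)).
have := sqr_sqrtr (ltW a0); have := sqr_sqrtr (ltW b0).
have := sqr_sqrtr (ltW c0); have := sqr_sqrtr (ltW e0).
move: (Num.sqrt a) (Num.sqrt b) (Num.sqrt c) (Num.sqrt e) => a' b' c' e'.
move=> <- <- <- <-.
have := sqr_ge0 (a' * e' - b' * c'); nra.
Qed.

(** Bounding every partial sum, rather than a series, makes the event a countable intersection of
    conditions on finite prefixes. *)
Definition small_tail m (r : R) : set cantor :=
  [set w | forall n, \sum_(m <= k < n) (1 - affinity (restrict w k)) <= r].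

Lemma measurable_small_tail m r : measurable (small_tail m r).
Proof.
have -> : small_tail m r = \bigcap_n [set w : cantor |
    \sum_(m <= k < n) (1 - affinity (take k (restrict w n))) <= r].
  have E (w : cantor) n : \sum_(m <= k < n) (1 - affinity (restrict w k)) =
      \sum_(m <= k < n) (1 - affinity (take k (restrict w n))).
    by apply: eq_big_nat => k /andP[_ /ltnW kn]; rewrite take_restrict.
  by apply/seteqP; split=> [w h n _|w h n] /=; [rewrite -E|rewrite E; exact: h].
apply: bigcap_measurable => // n _.
exact: (@measurable_prefix_set n
  (fun s => \sum_(m <= k < n) (1 - affinity (take k s)) <= r)).
Qed.

(* The budget [r] bounds the total defect still allowed below [s], so the
   recursion stops wherever it is exhausted; [x + c^2 y - 2 (1 - r) c sqrt (x y)]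
   dominates the squared Hellinger distance, over the stopped leaves, between
   [nu] and [c^2 mu]. *)
Lemma small_tail_le (c r : R) (s : seq bool) (p : pred (seq bool)) (n : nat) :
  0 <= c -> 0 <= r <= 1 -> (size s <= n)%N ->
  fine (nu (cylinder s `&` (prefix_set n p `&` small_tail (size s) r))) <=
    2 * c ^+ 2 * fine (mu (cylinder s `&` prefix_set n p)) +
    2 * (x s + c ^+ 2 * y s - 2 * (1 - r) * c * Num.sqrt (x s * y s)).
Proof.
move=> c0 r01 sn; set C := prefix_set n p.
have mC : measurable C by exact: measurable_prefix_set.
have mcyl u := measurable_cylinder u.
(* With [a] and [b] the roots of [x t] and [y t], the bracket is $(a - cb)^2 + 2qcab$, and the
   second inequality follows from $(a - 2cb)^2 \ge 0$. *)
have main : forall t q, 0 <= q <= 1 -> 0 <= x t + c ^+ 2 * y t -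
    2 * (1 - q) * c * Num.sqrt (x t * y t) /\
    x t <= 2 * c ^+ 2 * y t + 2 * (x t + c ^+ 2 * y t -
    2 * (1 - q) * c * Num.sqrt (x t * y t)).
  move=> t q /andP[q0 q1].
  have xt := sqr_sqrtr (ltW (x_gt0 t)); have yt := sqr_sqrtr (ltW (y_gt0 t)).
  rewrite (sqrtrM _ (ltW (x_gt0 t))); move: xt yt (sqrtr_ge0 (x t)) (sqrtr_ge0 (y t)).
  move: (Num.sqrt (x t)) (Num.sqrt (y t)) => a b <- <- a0 b0.
  have cab : 0 <= q * (c * a * b) by rewrite !mulr_ge0.
  have h1 := sqr_ge0 (a - c * b); have h2 := sqr_ge0 (a - 2 * (c * b)).
  by split; nra.
(* Induction on the distance from [s] to level [n], for all budgets [r] at once. *)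
move ed : (n - size s)%N => d.
elim: d s r r01 sn ed => [|d IH] s r r01 sn ed; have [ge0 lex] := main s r r01.
  have {sn ed}ns : n = size s by apply/eqP; rewrite eqn_leq sn -subn_eq0 ed.
  (* At a leaf, [C] either contains the cylinder or misses it. *)
  have [ps|nps] := boolP (p s).
    rewrite (_ : cylinder s `&` C = cylinder s); last first.
      apply/seteqP; split=> [w []//|w sw]; split=> //=.
      by rewrite /C /prefix_set /= ns sw.
    apply: le_trans lex; apply: fine_measure_le => //.
    apply: measurableI => //; apply: measurableI => //.
    exact: measurable_small_tail.
  rewrite (_ : cylinder s `&` (C `&` _) = set0); last first.
    apply/seteqP; split=> [w [sw [+ _]]|//].
    by rewrite /C /prefix_set /= ns sw (negPf nps).
  rewrite measure0 addr_ge0// mulr_ge0// ?fine_measure_ge0//.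
  by rewrite mulr_ge0// sqr_ge0.
(* When the first term alone exceeds [r], no path through [s] lies in the event, and the right-hand
   side is nonnegative. *)
have [ltr|ler] := ltP r (1 - affinity s).
  rewrite (_ : cylinder s `&` (C `&` _) = set0); last first.
    apply/seteqP; split=> [w [sw [_ /(_ (size s).+1)]]|//].
    by rewrite big_nat1 sw leNgt ltr.
  rewrite measure0 addr_ge0// mulr_ge0// ?fine_measure_ge0//.
  by rewrite mulr_ge0// sqr_ge0.
(* The budget left to both children once the defect at [s] is paid. *)
pose r' := r - (1 - affinity s).
have a1 := affinity_le1 s.
have r'01 : 0 <= r' <= 1.
  by case/andP: r01 => r0 r1; rewrite /r'; apply/andP; split; lra.
have step b : fine (nu (cylinder (rcons s b) `&`
      (C `&` small_tail (size s) r))) <=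
    2 * c ^+ 2 * fine (mu (cylinder (rcons s b) `&` C)) +
    2 * (x (rcons s b) + c ^+ 2 * y (rcons s b) -
      2 * (1 - r') * c * Num.sqrt (x (rcons s b) * y (rcons s b))).
  apply: le_trans (IH (rcons s b) r' r'01 _ _).
  - apply: fine_measure_le.
    + apply: measurableI; [exact: mcyl|apply: measurableI => //].
      exact: measurable_small_tail.
    + apply: measurableI; [exact: mcyl|apply: measurableI => //].
      exact: measurable_small_tail.
    + move=> w [/[dup] /cylinder_rcons[sw _] sbw [Cw tw]].
      split=> //; split=> // N; rewrite size_rcons.
      have [Ns|sN] := leqP N (size s).+1.
        by rewrite big_geq//; case/andP: r'01.
      have := tw N; rewrite big_ltn; last exact: ltnW.
      by rewrite sw /r'; lra.
  - by rewrite size_rcons -subn_gt0 ed.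
  - by rewrite size_rcons subnS ed.
have mA : measurable (C `&` small_tail (size s) r).
  by apply: measurableI => //; exact: measurable_small_tail.
rewrite (fine_measure_cylinderI nu s mA) (fine_measure_cylinderI mu s mC).
have xs : x s = x (rcons s true) + x (rcons s false) by exact: fine_measure_cylinder.
have ys : y s = y (rcons s true) + y (rcons s false) by exact: fine_measure_cylinder.
have as_ : Num.sqrt (x (rcons s true) * y (rcons s true)) +
    Num.sqrt (x (rcons s false) * y (rcons s false)) =
    affinity s * Num.sqrt (x s * y s).
  by rewrite divfK// gt_eqF// sqrtr_gt0 mulr_gt0.
apply: le_trans (lerD (step true) (step false)) _.
(* With $u = 1 - \alpha$, where $\alpha$ is the affinity at [s], the two sides differ by $u r' \ge
   0$. This lets the children's bounds add up to the bound at [s]. *)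
have budget : 1 - r <= (1 - r') * affinity s.
  by case/andP: r'01; rewrite /r'; nra.
have := ler_wpM2r (mulr_ge0 c0 (sqrtr_ge0 (x s * y s))) budget.
have -> : (1 - r') * affinity s * (c * Num.sqrt (x s * y s)) =
  (1 - r') * c * (affinity s * Num.sqrt (x s * y s)) by ring.
by rewrite -as_ xs ys; lra.
Qed.

End hellinger_defect.

(** * Simultaneous clopen approximation in two measures *)

Section approximation.
Context (R : realType) (P Q : probability cantor R).

Lemma prefix_set_widen m n p : (m <= n)%N ->
  prefix_set m p = prefix_set n (fun s => p (take m s)).
Proof.
by move=> mn; apply/seteqP; split=> w; rewrite /prefix_set /= take_restrict.
Qed.

Let prefix_approximable : set (set cantor) := [set A | measurable A /\
  forall e : R, 0 < e -> exists n p,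
    fine (P (A `+` prefix_set n p)) < e /\ fine (Q (A `+` prefix_set n p)) < e].

(** Dynkin's argument: the approximable sets form a lambda-system containing the pi-system of prefix
    sets, which generates the Borel sets. One prefix set must serve both measures, since the same
    clopen set is later weighed by [nu] and by [mu]. *)
Lemma measurable_prefix_approximable : measurable `<=` prefix_approximable.
Proof.
pose G : set (set cantor) := [set A | exists n p, A = prefix_set n p].
have mY B n p : measurable B -> measurable (B `+` prefix_set n p).
  move=> mB; have mp := measurable_prefix_set n p.
  by apply: measurableU; exact: measurableD.
have lambda : lambda_system setT prefix_approximable.
  split=> //.
  - split=> // e e0; exists 0%N, predT.
    rewrite (_ : prefix_set 0 predT = setT); last exact/seteqP.
    by rewrite setYK !measure0.
  - move=> B C CB [mB apB] [mC apC]; split; first exact: measurableD.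
    move=> e e0; have e20 : 0 < e / 2 by rewrite divr_gt0.
    have [m [p [PB QB]]] := apB _ e20; have [n [q [PC QC]]] := apC _ e20.
    pose k := maxn m n.
    exists k, (fun s => p (take m s) && ~~ q (take n s)).
    have sub : (B `\` C) `+` prefix_set k
        (fun s => p (take m s) && ~~ q (take n s)) `<=`
        (B `+` prefix_set m p) `|` (C `+` prefix_set n q).
      rewrite (prefix_set_widen p (leq_maxl m n)).
      rewrite (prefix_set_widen q (leq_maxr m n)).
      move=> w [[[Bw nCw] /negP]|[/andP[pw nqw] nBCw]].
        rewrite negb_and negbK => /orP[npw|qw]; last by right; right.
        by left; left; split=> //; exact/negP.
      have [Bw|nBw] := pselect (B w); last by left; right.
      right; left; split; last exact/negP.
      by apply: contrapT => nCw; exact: nBCw.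
    have mBC : measurable (B `\` C) by exact: measurableD.
    split; (apply: le_lt_trans (fine_measure_leU _ _ _ _ sub) _;
      [exact: mY|exact: mY|exact: mY|lra]).
  - move=> F ndF apF; have mF n : measurable (F n) by have [] := apF n.
    have mUF : measurable (\bigcup_n F n) by exact: bigcup_measurable.
    split=> // e e0; have e20 : 0 < e / 2 by rewrite divr_gt0.
    (* One stage is close to the union in both measures; its approximant then serves for the
       union. *)
    have [N0 _ h] : \forall n \near \oo,
        fine (P ((\bigcup_k F k) `\` F n)) < e / 2 /\
        fine (Q ((\bigcup_k F k) `\` F n)) < e / 2.
      apply: filter_app (near_fine_measure_setD Q e20 mF ndF).
      apply: filterS (near_fine_measure_setD P e20 mF ndF).
      by move=> n ? ?.
    have [PN QN] := h N0 (leqnn _).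
    have [_ /(_ _ e20)[n [p [PC QC]]]] := apF N0.
    exists n, p.
    have sub : (\bigcup_k F k) `+` prefix_set n p `<=`
        ((\bigcup_k F k) `\` F N0) `|` (F N0 `+` prefix_set n p).
      move=> w /= [[Fw nw]|[pw nF]]; have [FN|nFN] := pselect (F N0 w).
      - by right; left.
      - by left.
      - by exfalso; apply: nF; exists N0.
      - by right; right.
    split; (apply: le_lt_trans (fine_measure_leU _ _ _ _ sub) _;
      [exact: mY|exact: measurableD|exact: mY|lra]).
have GI : setI_closed G.
  move=> _ _ [m [p ->]] [n [q ->]].
  exists (maxn m n), (fun s => p (take m s) && q (take n s)).
  rewrite (prefix_set_widen p (leq_maxl m n)).
  rewrite (prefix_set_widen q (leq_maxr m n)).
  by apply/seteqP; split=> w; rewrite /prefix_set /= => /andP.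
have GH : G `<=` prefix_approximable.
  move=> _ [n [p ->]]; split; first exact: measurable_prefix_set.
  move=> e e0; exists n, p.
  by rewrite setYK !measure0.
move=> A mA; apply: (lambda_system_subset GI lambda GH) => //.
move: A mA; apply: (smallest_sub (smallest_sigma_algebra setT G)).
move=> _ [s _ <-]; apply: sub_gen_smallest.
exists (size s), (pred1 s); apply/seteqP.
by split=> w; rewrite /prefix_set /= => /eqP.
Qed.

(** Widening pushes the level past [N], as [small_tail_le] requires a level at least the length of
    [s]. *)
Lemma measurable_prefix_approx (A : set cantor) (e : R) (N : nat) :
  measurable A -> 0 < e -> exists n p, [/\ (N <= n)%N,
    fine (P (A `+` prefix_set n p)) < e & fine (Q (A `+` prefix_set n p)) < e].
Proof.
move=> /measurable_prefix_approximable[_ h] /h[n [p [Pe Qe]]].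
exists (maxn N n), (fun s => p (take n s)).
by rewrite -prefix_set_widen ?leq_maxl ?leq_maxr.
Qed.

End approximation.

(** * From small tails to absolute continuity *)

Section null_sets.
Context (R : realType) (nu mu : probability cantor R).
Hypotheses (nu_full : full_support nu) (mu_full : full_support mu).

Lemma null_small_tail_le (A : set cantor) (r : R) (s : seq bool) :
  measurable A -> mu A = 0%E -> 0 <= r <= 1 ->
  fine (nu (cylinder s `&` (A `&` small_tail nu mu (size s) r))) <=
    4 * r * fine (nu (cylinder s)).
Proof.
move=> mA muA0 r01; have mcyl u := measurable_cylinder u.
have mT := measurable_small_tail nu mu (size s) r.
have := mass_gt0 s nu_full; have := mass_gt0 s mu_full.
set x := fine (nu _); set y := fine (mu _) => y0 x0.
have K0 : 0 <= x / y by rewrite divr_ge0// ltW.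
apply/ler_addgt0Pr => e e0.
(* The approximation error enters once through [nu] and, with weight $2c^2 = 2x/y$, once through
   [mu]; the total is [e]. *)
pose e' := e / (1 + 2 * (x / y)).
have e'0 : 0 < e' by rewrite divr_gt0// ltr_wpDr// mulr_ge0.
have [n [p [sn nuAC muAC]]] := measurable_prefix_approx nu mu (size s) mA e'0.
have mC := measurable_prefix_set n p; set C := prefix_set n p in mC nuAC muAC *.
have mAC : measurable (A `+` C) by apply: measurableU; exact: measurableD.
(* This scaling makes both $c^2 y$ and $c\sqrt{xy}$ equal to $x$, so the bracket of [small_tail_le]
   collapses to $2rx$ and its double to $4rx$. *)
pose c := Num.sqrt (x / y).
have c2 : c ^+ 2 = x / y by rewrite sqr_sqrtr.
have c2y : c ^+ 2 * y = x by rewrite c2 divfK// gt_eqF.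
have cxy : c * Num.sqrt (x * y) = x.
  rewrite -sqrtrM// mulrCA -mulrA mulVf ?gt_eqF// mulr1 -expr2.
  by rewrite sqrtr_sqr gtr0_norm.
have := small_tail_le nu_full mu_full p (sqrtr_ge0 (x / y)) r01 sn.
rewrite -/x -/y -/c -/C c2y -[_ * c * _]mulrA cxy => key.
have le1 : fine (nu (cylinder s `&` (A `&` small_tail nu mu (size s) r))) <=
    fine (nu (A `+` C)) +
    fine (nu (cylinder s `&` (C `&` small_tail nu mu (size s) r))).
  apply: fine_measure_leU => //.
  - by apply: measurableI => //; exact: measurableI.
  - by apply: measurableI => //; exact: measurableI.
  - move=> w [sw [Aw tw]]; have [Cw|nCw] := pselect (C w).
      by right.
    by left; left.
have le2 : fine (mu (cylinder s `&` C)) <= fine (mu A) + fine (mu (A `+` C)).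
  apply: fine_measure_leU => //; first exact: measurableI.
  move=> w [_ Cw]; have [Aw|nAw] := pselect (A w); first by left.
  by right; right.
rewrite muA0 /= add0r in le2.
have le3 : c ^+ 2 * fine (mu (cylinder s `&` C)) <= x / y * e'.
  by rewrite c2 ler_wpM2l// (le_trans le2)// ltW.
have ee' : e = e' + 2 * (x / y * e').
  by rewrite /e'; field; rewrite gt_eqF//= gt_eqF//; nra.
lra.
Qed.

(** The bounds for the strings of length [m] are summed up the tree to the root; [d] is the depth
    still below [s]. *)
Lemma null_small_tail_le_setT (A : set cantor) (r : R) (m : nat) :
  measurable A -> mu A = 0%E -> 0 <= r <= 1 ->
  fine (nu (A `&` small_tail nu mu m r)) <= 4 * r.
Proof.
move=> mA muA0 r01.
have mAT : measurable (A `&` small_tail nu mu m r).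
  by apply: measurableI => //; exact: measurable_small_tail.
suff main d s : (size s + d = m)%N ->
    fine (nu (cylinder s `&` (A `&` small_tail nu mu m r))) <=
    4 * r * fine (nu (cylinder s)).
  have := main m [::] (add0n _).
  have -> : cylinder [::] = setT by apply/seteqP.
  by rewrite setTI probability_setT mulr1.
elim: d s => [|d IH] s; first by rewrite addn0 => <-; exact: null_small_tail_le.
rewrite addnS -addSn => sd.
rewrite (fine_measure_cylinderI nu s mAT) (fine_measure_cylinder nu s) mulrDr.
by apply: lerD; apply: IH; rewrite size_rcons.
Qed.

Lemma null_of_small_tails (A : set cantor) : measurable A -> mu A = 0%E ->
  (forall r : R, 0 < r ->
     {ae nu, forall w, exists m, small_tail nu mu m r w}) ->
  nu A = 0%E.
Proof.
move=> mA muA0 tails; apply: null_fine_measure => //.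
apply/eqP; rewrite eq_le fine_measure_ge0 andbT; apply/ler_addgt0Pr => e e0.
(* The tail estimate costs at most $4e/5$, leaving $e/5$ for the paths whose tail is not yet small;
   the minimum keeps [r] at most 1. *)
rewrite add0r; pose r := Num.min 1 (e / 5).
have r0 : 0 < r by rewrite lt_min ltr01 divr_gt0.
have r01 : 0 <= r <= 1 by rewrite (ltW r0) ge_min lexx.
have re : r <= e / 5 by rewrite ge_min lexx orbT.
pose F m := small_tail nu mu m r.
have mF m : measurable (F m) by exact: measurable_small_tail.
have ndF : nondecreasing_seq F.
  (* Raising [m] drops a first term, which is nonnegative by [affinity_le1]. *)
  apply/nondecreasing_seqP => m; apply/subsetPset => w Fw n.
  have [nm|mn] := leqP n m.
    by rewrite big_geq ?(leq_trans nm)//; case/andP: r01.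
  have := Fw n; rewrite big_ltn//.
  have := affinity_le1 nu_full mu_full (restrict w m); lra.
have e50 : 0 < e / 5 by rewrite divr_gt0.
have [N _ /(_ N (leqnn _)) FN] := near_fine_measure_setD nu e50 mF ndF.
have [B [mB nuB0 AB]] := tails _ r0.
have mUF : measurable (\bigcup_m F m) by exact: bigcup_measurable.
have mD : measurable ((\bigcup_m F m) `\` F N) by exact: measurableD.
have mAF : measurable (A `&` F N) by exact: measurableI.
have le1 : fine (nu A) <= fine (nu ((A `&` F N) `|` ((\bigcup_m F m) `\` F N))) +
    fine (nu B).
  apply: fine_measure_leU => //; first exact: measurableU.
  move=> w Aw; have [Bw|nBw] := pselect (B w); [by right|left].
  have [m Fm] : exists m, F m w by apply: contrapT => nFw; exact: nBw (AB _ nFw).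
  by have [FNw|nFNw] := pselect (F N w); [left|right; split=> //; exists m].
have le2 : fine (nu ((A `&` F N) `|` ((\bigcup_m F m) `\` F N))) <=
    fine (nu (A `&` F N)) + fine (nu ((\bigcup_m F m) `\` F N)).
  by apply: fine_measure_leU => //; exact: measurableU.
have := null_small_tail_le_setT N mA muA0 r01.
rewrite nuB0 /= in le1; rewrite -/(F N); lra.
Qed.

(** Tails of a convergent series tend to 0. Here [h] stands for the squared Hellinger distances,
    half of which dominate the defects. *)
Lemma summable_small_tail (h : nat -> R) (w : cantor) (r : R) : 0 < r ->
  (forall n, 0 <= h n) ->
  (forall n, 1 - affinity nu mu (restrict w n) <= h n / 2) ->
  (\sum_(n <oo) (h n)%:E < +oo)%E -> exists m, small_tail nu mu m r w.
Proof.
move=> r0 h0 ah sumh.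
have cvg0 := @nneseries_tail_cvg R (EFin \o h) xpredT sumh (fun k _ => h0 k).
have [m _ /(_ m (leqnn _)) /= tailm] : \forall m \near \oo,
    (\sum_(m <= k <oo) (h k)%:E < r%:E)%E.
  by apply: (cvg0 [set z | (z < r%:E)%E]); exact: (@nbhs_open_ereal_lt R 0 (fun=> r)).
exists m => n.
apply: le_trans (_ : \sum_(m <= k < n) h k / 2 <= _).
  by apply: ler_sum => k _.
have /le_lt_trans/(_ tailm) :=
  @nneseries_lim_ge R (EFin \o h) xpredT m n (fun k _ _ => h0 k).
rewrite /= sumEFin lte_fin -mulr_suml => ?.
have : 0 <= \sum_(m <= k < n) h k by apply: sumr_ge0.
lra.
Qed.

End null_sets.

(** * One-step Hellinger distance in terms of the affinity *)

Section conditional_hellinger.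
Context (R : realType).
Implicit Types nu mu : probability cantor R.

Lemma restrictF_conditionalE n nu s (A : set (cantorF n)) : full_support nu ->
  restrictF n (conditional nu s) A =
  (nu (A `&` cylinder s) * ((fine (nu (cylinder s)))^-1)%:E)%E.
Proof.
move=> nu_full; rewrite [LHS](_ : _ =
  mnormalize (mrestr nu (measurable_cylinder s)) nu (A : set cantor))//.
(* Full support and finiteness exclude the default branch of [mnormalize]. *)
rewrite /mnormalize /= /mrestr setTI (gt_eqF (nu_full s)) /= lt_eqF//.
by rewrite ltey_eq fin_num_measure//; exact: measurable_cylinder.
Qed.

(** Saturated sets form a sigma-algebra containing the generating cylinders. This makes the
    cylinders of length [n] behave as atoms, on which measurable functions are constant. *)
Lemma measurable_cantorF_saturated n (A : set (cantorF n)) : measurable A ->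
  forall v w : cantor, restrict v n = restrict w n -> A v -> A w.
Proof.
pose saturated : set (set (cantorF n)) :=
  [set A | forall v w : cantor, restrict v n = restrict w n -> A v -> A w].
suff : measurable `<=` saturated by move=> h /h.
apply: smallest_sub.
  split=> [v w //|B satB v w vw [_ nBv]|F satF v w vw [k _ Fkv]].
    by split=> // Bw; apply: nBv; exact: satB (esym vw) Bw.
  by exists k => //; exact: satF vw Fkv.
by move=> _ [s /= sn <-] v w; rewrite /cylinder /= sn => -> .
Qed.

(** Given [s], only the two child cylinders carry mass, so the expectation defining the Hellinger
    distance is a two-term sum, namely the affinity. *)
Lemma affinity_le_hellingerF n nu mu (w : cantor) :
  full_support nu -> full_support mu ->
  1 - affinity nu mu (restrict w n) <= hellingerF n nu mu w ^+ 2 / 2.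
Proof.
move=> nu_full mu_full; rewrite /hellingerF.
(* Replacing [n] by the length of [s] lets the type [cantorF] follow the string. *)
have : size (restrict w n) = n by exact: size_mkseq.
move: (restrict w n) => {w} s ns; case: n / ns.
set P := restrictF _ (conditional nu s); set Q := restrictF _ (conditional mu s).
pose x t := fine (nu (cylinder t)); pose y t := fine (mu (cylinder t)).
have x_gt0 t : 0 < x t by exact: mass_gt0.
have y_gt0 t : 0 < y t by exact: mass_gt0.
pose t b := rcons s b.
have st b : size (t b) = (size s).+1 by rewrite size_rcons.
have mct b : measurable (cylinder (t b) : set (cantorF (size s).+1)).
  by apply: sub_sigma_algebra; exists (t b) => //=; rewrite st.
have ctE b : cylinder (t b) `&` cylinder s = cylinder (t b).
  by apply/setIidl => w /cylinder_rcons[].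
have Pt b : P (cylinder (t b)) = (x (t b) / x s)%:E.
  rewrite /P restrictF_conditionalE// ctE EFinM /x fineK//.
  by rewrite fin_num_measure//; exact: measurable_cylinder.
have Qt b : Q (cylinder (t b)) = (y (t b) / y s)%:E.
  rewrite /Q restrictF_conditionalE// ctE EFinM /y fineK//.
  by rewrite fin_num_measure//; exact: measurable_cylinder.
have PQ : charge_of_finite_measure P `<< Q.
  apply/null_content_dominatesP => A mA QA0.
  (* A measurable set meeting the cylinder of [s] contains a whole child cylinder, which has
     positive [Q]-mass. *)
  suff As0 : A `&` cylinder s = set0.
    rewrite [LHS](_ : _ = P A)//.
    by rewrite /P restrictF_conditionalE// As0 measure0 mul0e.
  apply/seteqP; split=> // w [Aw sw].
  have tA : cylinder (t (w (size s))) `<=` A.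
    move=> v vt; apply: (measurable_cantorF_saturated mA _ Aw).
    by move: vt; rewrite /cylinder /= st => ->; rewrite restrictS sw.
  have : (Q (cylinder (t (w (size s)))) <= Q A)%E by rewrite le_measure ?inE.
  by rewrite QA0 Qt lee_fin leNgt divr_gt0.
pose f := Radon_Nikodym (charge_of_finite_measure P) Q.
have intf : Q.-integrable setT f by exact: Radon_Nikodym_integrable.
have mf := measurable_int Q intf.
(* The derivative is constant on each child cylinder, an atom; integrating it there identifies the
   constant as the ratio of the two masses. *)
have fct b : exists2 c : R, (forall v : cantor, cylinder (t b) v -> f v = c%:E) &
    c = (x (t b) / x s) / (y (t b) / y s).
  pose w : cantor := fun i => nth false (t b) i.
  have tw : cylinder (t b) w.
    rewrite /cylinder /=; apply: (@eq_from_nth _ false); rewrite size_mkseq//.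
    by move=> i it; rewrite nth_mkseq.
  have fw v : cylinder (t b) v -> f v = f w.
    move=> tv; have mfw : measurable (f @^-1` [set f w]).
      by rewrite -[X in measurable X]setTI; exact: mf.
    apply: (measurable_cantorF_saturated mfw (v := w)) => //.
    by move: tv tw; rewrite /cylinder /= st => -> ->.
  have fwfin : f w \is a fin_num by exact: Radon_Nikodym_fin_num.
  exists (fine (f w)) => [v /fw ->|]; first by rewrite fineK.
  apply/(canRL (mulfK _)); first by rewrite gt_eqF// divr_gt0.
  apply: EFin_inj; rewrite EFinM fineK// -Qt -Pt.
  rewrite [RHS](Radon_Nikodym_integral PQ (mct b)) -/f.
  rewrite -integral_cst//; apply: eq_integral => v; rewrite inE => tv.
  by rewrite fw.
pose g (v : cantorF (size s).+1) : R := Num.sqrt (fine (f v)).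
have mg : measurable_fun setT (fun v => (g v)%:E).
  apply/measurable_EFinP; apply: measurableT_comp => //.
    by apply: continuous_measurable_fun; exact: sqrt_continuous.
  exact: measurableT_comp mf.
have intg b : (\int[Q]_(v in cylinder (t b)) (g v)%:E =
    (Num.sqrt (x (t b) * y (t b)) / Num.sqrt (x s * y s))%:E)%E.
  have [c fc cE] := fct b.
  transitivity (\int[Q]_(v in cylinder (t b)) (cst (Num.sqrt c)%:E) v)%E.
    by apply: eq_integral => v; rewrite inE => tv; rewrite /g fc.
  rewrite integral_cst// [X in (_ * X)%E](_ : _ = (y (t b) / y s)%:E);
    last exact: Qt.
  rewrite -EFinM; congr EFin.
  have xn0 u : x u != 0 by rewrite gt_eqF.
  have yn0 u : y u != 0 by rewrite gt_eqF.
  have q0 : 0 < y (t b) / y s by rewrite divr_gt0.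
  have c0 : 0 <= c by rewrite cE divr_ge0// divr_ge0// ltW.
  have xy0 u : 0 <= x u * y u by rewrite mulr_ge0// ltW.
  (* The factor $q = y(t_b)/y(s)$ is absorbed as $\sqrt{q^2}$, so that both sides are single square
     roots. *)
  rewrite -[in LHS](gtr0_norm q0) -sqrtr_sqr -sqrtrM//.
  rewrite -sqrtrV// -sqrtrM//; congr Num.sqrt.
  by rewrite cE; field; rewrite !xn0 !yn0.
have csU : cylinder s = cylinder (t true) `|` cylinder (t false).
  apply/seteqP; split=> [v sv|v [/cylinder_rcons[]|/cylinder_rcons[]]//].
  by case: (v (size s)) /idP => [vt|/negP/negPf vf]; [left|right];
    apply/cylinder_rcons.
have mcs : measurable (cylinder s : set (cantorF (size s).+1)).
  by rewrite csU; exact: measurableU.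
have EE : ('E_Q[g] = (affinity nu mu s)%:E)%E.
  (* The complement of the cylinder of [s] is [Q]-null and is discarded. *)
  rewrite unlock (ge0_negligible_integral (N := ~` (cylinder s : set (cantorF (size s).+1))))//.
  - rewrite setTD setCK csU ge0_integral_setU//.
    + by rewrite !intg -EFinD -mulrDl.
    + exact: measurable_funTS.
    + by move=> v _; rewrite lee_fin sqrtr_ge0.
    + by apply/disj_setPS => v [/cylinder_rcons[_ vt] /cylinder_rcons[_]]; rewrite vt.
  - exact: measurableC.
  - by move=> v _; rewrite lee_fin sqrtr_ge0.
  - rewrite [LHS](_ : _ = Q (~` cylinder s))//.
    by rewrite /Q restrictF_conditionalE// setICl measure0 mul0e.
rewrite /hellinger -/f -/g EE /=.
set a := affinity nu mu s.
(* On a negative argument [Num.sqrt] is 0, and the bound is then immediate. *)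
have [a1|/ltW a1] := leP 0 (2 * (1 - a)).
  by rewrite sqr_sqrtr//; lra.
by rewrite ler0_sqrtr//; lra.
Qed.

End conditional_hellinger.

Theorem corollary1p8 (R : realType)
  (S : set (probability cantor R))
  (prec : probability cantor R -> probability cantor R -> Prop)
  (S_full_support : forall rho, S rho -> full_support rho)
  (prec_refl : reflexive_relation_on S prec)
  (nu mu : probability cantor R)
  (nu_computable : computable_measure nu) (nu_full : full_support nu)
  (mu_computable : computable_measure mu) (mu_full : full_support mu)
  (MR2_nu_ae : {ae nu, forall w : cantor, MR2_hellinger nu prec w})
  (prec_nu_mu : prec nu mu) :
  nu `<< mu.
Proof.
apply/null_content_dominatesP => A mA muA0.
apply: (null_of_small_tails nu_full mu_full mA muA0) => r r0.
apply: filterS MR2_nu_ae => w MRw.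
(* The measure [mu] is itself an admissible [mu'] in [MR2_hellinger], which yields the summability
   at [w]. *)
apply: (summable_small_tail (h := fun n => hellingerF n nu mu w ^+ 2)) => //.
- by move=> n; exact: sqr_ge0.
- by move=> n; exact: affinity_le_hellingerF.
- exact: MRw.
Qed.
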